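(* Let $Q,Q'$ be finite quivers, $k=\mathbb{F}_q$, and let $F$ be a functor from $\mathrm{mod}(Q)$ to $\mathrm{mod}(Q')$ such that $F$ induces an onto map $\mathrm{Ext}_Q(U,V)\to\mathrm{Ext}_{Q'}(F(U),F(V))$ with equicardinal fibres (for all $U,V$). Then the map $H(F)_*:H(Q)\to H(Q')$ defined by $$[M]\mapsto\frac{a_{F(M)}}{a_M}[F(M)]$$ is an algebra morphism.
   Context: $\mathrm{mod}(Q)$ is the category of finite-dimensional representations of $Q$ over $k=\mathbb{F}_q$; $\mathrm{Ext}=\mathrm{Ext}^1$; the induced map on $\mathrm{Ext}$ is the one obtained by applying $F$ to extensions; equicardinal fibres means that all fibres of the map have the same cardinality. $a_M$ denotes the order of the automorphism group of $M$. The additive Euler form of $Q$ is $\langle\alpha,\beta\rangle_a=\sum_{v\in Q_0}\alpha(v)\beta(v)-\sum_{a\in Q_1}\alpha(ta)\beta(ha)$, where $Q_0$ is the set of vertices, $Q_1$ the set of arrows, and an arrow $a$ goes from $ta$ to $ha$; $\langle\alpha,\beta\rangle:=q^{\langle\alpha,\beta\rangle_a}$; similarly for $Q'$. Here $H(Q)$ is the twisted version of the (completed) Hall algebra: the space of all formal (possibly infinite) $\mathbb{C}$-linear combinations of isomorphism classes $[M]$ of objects of $\mathrm{mod}(Q)$, with unit $[0]$ and multiplication $$[U][V]:=\sum_{[W]}\langle\underline{\dim}U,\underline{\dim}V\rangle F_{UV}^W[W],$$ where $\underline{\dim}$ denotes the dimension vector and $F_{UV}^W$ is the number of subrepresentations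 $V'\subset W$ with $V'\cong V$ and $W/V'\cong U$. $H(Q')$ is defined in the same way using the Euler form of $Q'$.
   Formalization: F is taken to send short exact sequences to short exact sequences, and the map is taken on the subalgebra of formal combinations for which each coefficient of the image is a finite sum (all of H(Q) if F has finite fibres on isomorphism classes), since it is undefined elsewhere (e.g. F=0). *)

(* Defs.v *)
From HB Require Import structures.
From mathcomp Require Import all_boot all_order all_algebra.
From mathcomp Require Import boolp classical_sets functions cardinality fsbigop.
From mathcomp Require Import reals.
From mathcomp Require Import complex.

Set Implicit Arguments.
Unset Strict Implicit.
Unset Printing Implicit Defensive.

Import Order.TTheory GRing.Theory Num.Theory.
Local Open Scope classical_set_scope.
Local Open Scope quotient_scope.
Local Open Scope ring_scope.

Record quiver := Quiver {
  vertex : finType;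
  arrow : finType;
  tail : arrow -> vertex;
  head : arrow -> vertex }.

Section Representations.
Variables (k : finFieldType) (Q : quiver).

(* A representation of dimension vector d has the space of row vectors
   'rV[k]_(d v) at the vertex v, linear maps being matrices acting on the right.
   Every finite-dimensional representation is isomorphic to one of this form,
   so this category is equivalent to mod(Q). *)
Record rep := Rep {
  dimv :> vertex Q -> nat;
  rep_map : forall a : arrow Q, 'M[k]_(dimv (tail a), dimv (head a)) }.

HB.instance Definition _ := gen_eqMixin rep.
HB.instance Definition _ := gen_choiceMixin rep.

Definition commutes (M N : rep) (f : {dffun forall v, 'M[k]_(M v, N v)}) : bool :=
  [forall a, rep_map M a *m f (head a) == f (tail a) *m rep_map N a].

Record hom (M N : rep) := Hom {
  hom_fun : {dffun forall v, 'M[k]_(M v, N v)};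
  hom_commutes : commutes hom_fun }.

HB.instance Definition _ (M N : rep) := [isSub for @hom_fun M N].
HB.instance Definition _ (M N : rep) := [Finite of hom M N by <:].

Definition hom_at (M N : rep) (f : hom M N) (v : vertex Q) : 'M[k]_(M v, N v) :=
  hom_fun f v.

Lemma hom_atP (M N : rep) (f : hom M N) a :
  rep_map M a *m hom_at f (head a) = hom_at f (tail a) *m rep_map N a.
Proof. exact/eqP/(forallP (hom_commutes f)). Qed.

Lemma hom_ext (M N : rep) (f g : hom M N) :
  (forall v, hom_at f v = hom_at g v) -> f = g.
Proof. by move=> fg; apply/val_inj/ffunP => v; exact: fg. Qed.

Lemma mk_hom_subproof (M N : rep) (f : forall v, 'M[k]_(M v, N v)) :
  (forall a, rep_map M a *m f (head a) = f (tail a) *m rep_map N a) ->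
  commutes [ffun v => f v].
Proof. by move=> fc; apply/forallP => a; rewrite !ffunE fc. Qed.

Definition mk_hom (M N : rep) (f : forall v, 'M[k]_(M v, N v)) fc : hom M N :=
  Hom (@mk_hom_subproof M N f fc).

Lemma mk_homE (M N : rep) (f : forall v, 'M[k]_(M v, N v)) fc v :
  hom_at (@mk_hom M N f fc) v = f v.
Proof. by rewrite /hom_at /= ffunE. Qed.

Lemma hom_id_subproof (M : rep) a :
  rep_map M a *m 1%:M = 1%:M *m rep_map M a.
Proof. by rewrite mulmx1 mul1mx. Qed.

Definition hom_id (M : rep) : hom M M :=
  @mk_hom M M (fun v => 1%:M) (@hom_id_subproof M).

Lemma hom_comp_subproof (M N P : rep) (g : hom N P) (f : hom M N) a :
  rep_map M a *m (hom_at f (head a) *m hom_at g (head a))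
  = (hom_at f (tail a) *m hom_at g (tail a)) *m rep_map P a.
Proof. by rewrite mulmxA hom_atP -!mulmxA hom_atP. Qed.

(* g after f *)
Definition hom_comp (M N P : rep) (g : hom N P) (f : hom M N) : hom M P :=
  @mk_hom M P (fun v => hom_at f v *m hom_at g v) (hom_comp_subproof g f).

Lemma hom_compA (M N P L : rep) (h : hom P L) (g : hom N P) (f : hom M N) :
  hom_comp h (hom_comp g f) = hom_comp (hom_comp h g) f.
Proof. by apply: hom_ext => v; rewrite !mk_homE mulmxA. Qed.

Lemma hom_comp1l (M N : rep) (f : hom M N) : hom_comp (hom_id N) f = f.
Proof. by apply: hom_ext => v; rewrite !mk_homE mulmx1. Qed.

Lemma hom_comp1r (M N : rep) (f : hom M N) : hom_comp f (hom_id M) = f.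
Proof. by apply: hom_ext => v; rewrite !mk_homE mul1mx. Qed.

Definition is_iso (M N : rep) (f : hom M N) : bool :=
  [exists g : hom N M, (hom_comp g f == hom_id M) && (hom_comp f g == hom_id N)].

Lemma is_isoP (M N : rep) (f : hom M N) :
  reflect (exists g : hom N M, hom_comp g f = hom_id M /\ hom_comp f g = hom_id N)
          (is_iso f).
Proof.
apply: (iffP existsP) => [[g /andP[/eqP gf /eqP fg]]|[g [gf fg]]]; exists g => //.
by rewrite gf fg !eqxx.
Qed.

Lemma is_iso_id (M : rep) : is_iso (hom_id M).
Proof. by apply/is_isoP; exists (hom_id M); rewrite hom_comp1l. Qed.

Lemma is_iso_comp (M N P : rep) (g : hom N P) (f : hom M N) :
  is_iso g -> is_iso f -> is_iso (hom_comp g f).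
Proof.
move=> /is_isoP[g' [g'g gg']] /is_isoP[f' [f'f ff']].
apply/is_isoP; exists (hom_comp f' g'); split.
  by rewrite -hom_compA [hom_comp g' _]hom_compA g'g hom_comp1l.
by rewrite -hom_compA [hom_comp f _]hom_compA ff' hom_comp1l.
Qed.

Definition isomorphic (M N : rep) : bool := [exists f : hom M N, is_iso f].

Lemma isomorphic_refl : reflexive isomorphic.
Proof. by move=> M; apply/existsP; exists (hom_id M); exact: is_iso_id. Qed.

Lemma isomorphic_sym : symmetric isomorphic.
Proof.
suff H M N : isomorphic M N -> isomorphic N M by move=> M N; apply/idP/idP; exact: H.
move/existsP => [f /is_isoP[g [gf fg]]]; apply/existsP.
by exists g; apply/is_isoP; exists f.
Qed.

Lemma isomorphic_trans : transitive isomorphic.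
Proof.
move=> N M P /existsP[f fi] /existsP[g gi]; apply/existsP.
by exists (hom_comp g f); exact: is_iso_comp.
Qed.

Canonical isomorphic_equiv :=
  EquivRel isomorphic isomorphic_refl isomorphic_sym isomorphic_trans.

Definition isoclass : Type := {eq_quot isomorphic_equiv}.
HB.instance Definition _ := Choice.on isoclass.

Definition class_of (M : rep) : isoclass := \pi_{eq_quot isomorphic_equiv} M.
Definition class_repr (c : isoclass) : rep :=
  repr (c : {eq_quot isomorphic_equiv}).

Lemma class_of_eq (M N : rep) : class_of M = class_of N <-> isomorphic M N.
Proof.
split; first by move=> MN; have /eqquotP := MN.
by move=> MN; apply/eqquotP.
Qed.

Lemma class_reprK (c : isoclass) : class_of (class_repr c) = c.
Proof. exact: reprK. Qed.

Definition aut_order (M : rep) : nat := #|[pred f : hom M M | is_iso f]|.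

Definition rep0 : rep := @Rep (fun _ => 0%N) (fun _ => 0).

Definition short_exact (V E U : rep) (i : hom V E) (p : hom E U) : Prop :=
  forall v, [/\ row_free (hom_at i v),
                (hom_at i v == kermx (hom_at p v))%MS &
                row_full (hom_at p v)].

(* Yoneda extensions 0 -> V -> E -> U -> 0 *)
Record extension (U V : rep) := Extension {
  ext_mid : rep;
  ext_inc : hom V ext_mid;
  ext_proj : hom ext_mid U;
  ext_exact : short_exact ext_inc ext_proj }.

HB.instance Definition _ (U V : rep) := gen_eqMixin (extension U V).
HB.instance Definition _ (U V : rep) := gen_choiceMixin (extension U V).

Definition ext_equiv (U V : rep) (e e' : extension U V) : bool :=
  [exists f : hom (ext_mid e) (ext_mid e'),
    [&& is_iso f, hom_comp f (ext_inc e) == ext_inc e' &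
        hom_comp (ext_proj e') f == ext_proj e]].

Lemma ext_equivP (U V : rep) (e e' : extension U V) :
  reflect (exists f : hom (ext_mid e) (ext_mid e'),
             [/\ is_iso f, hom_comp f (ext_inc e) = ext_inc e' &
                 hom_comp (ext_proj e') f = ext_proj e])
          (ext_equiv e e').
Proof.
apply: (iffP existsP) => [[f /and3P[fi /eqP fl /eqP fr]]|[f [fi fl fr]]].
  by exists f.
by exists f; rewrite fi fl fr !eqxx.
Qed.

Lemma ext_equiv_refl (U V : rep) : reflexive (@ext_equiv U V).
Proof.
move=> e; apply/ext_equivP; exists (hom_id _).
by rewrite hom_comp1l hom_comp1r; split => //; exact: is_iso_id.
Qed.

Lemma ext_equiv_sym (U V : rep) : symmetric (@ext_equiv U V).
Proof.
suff H e e' : @ext_equiv U V e e' -> ext_equiv e' e.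
  by move=> e e'; apply/idP/idP; exact: H.
move/ext_equivP => [f [/is_isoP[g [gf fg]] fi pf]].
apply/ext_equivP; exists g; split.
- by apply/is_isoP; exists f.
- by rewrite -fi hom_compA gf hom_comp1l.
- by rewrite -pf -hom_compA fg hom_comp1r.
Qed.

Lemma ext_equiv_trans (U V : rep) : transitive (@ext_equiv U V).
Proof.
move=> e2 e1 e3 /ext_equivP[f [fi fl fr]] /ext_equivP[g [gi gl gr]].
apply/ext_equivP; exists (hom_comp g f); split; first exact: is_iso_comp.
- by rewrite -hom_compA fl gl.
- by rewrite hom_compA gr fr.
Qed.

Canonical ext_equiv_rel (U V : rep) :=
  EquivRel (@ext_equiv U V) (@ext_equiv_refl U V) (@ext_equiv_sym U V)
    (@ext_equiv_trans U V).

Definition Ext (U V : rep) : Type := {eq_quot ext_equiv_rel U V}.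
HB.instance Definition _ (U V : rep) := Choice.on (Ext U V).

Definition ext_class (U V : rep) (e : extension U V) : Ext U V :=
  \pi_{eq_quot ext_equiv_rel U V} e.
Definition ext_repr (U V : rep) (c : Ext U V) : extension U V :=
  repr (c : {eq_quot ext_equiv_rel U V}).

Lemma ext_class_eq (U V : rep) (e e' : extension U V) :
  ext_class e = ext_class e' <-> ext_equiv e e'.
Proof.
split; first by move=> MN; have /eqquotP := MN.
by move=> MN; apply/eqquotP.
Qed.

Lemma ext_reprK (U V : rep) (c : Ext U V) : ext_class (ext_repr c) = c.
Proof. exact: reprK. Qed.

Section Subrepresentations.
Variable W : rep.

(* <<A>>%MS is a canonical matrix of the row space of A, so that each family of
   subspaces is represented exactly once. *)
Definition stable (S : {dffun forall v, 'M[k]_(W v)}) : bool :=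
  [forall v, <<S v>>%MS == S v] &&
  [forall a, (S (tail a) *m rep_map W a <= S (head a))%MS].

Record subrep := Subrep {
  sub_space : {dffun forall v, 'M[k]_(W v)};
  sub_stable : stable sub_space }.

HB.instance Definition _ := [isSub for sub_space].
HB.instance Definition _ := [Finite of subrep by <:].

Variable S : subrep.

Lemma sub_stableP a :
  (sub_space S (tail a) *m rep_map W a <= sub_space S (head a))%MS.
Proof. by have /andP[_ /forallP] := sub_stable S. Qed.

Definition sub_inc_at (v : vertex Q) : 'M[k]_(\rank (sub_space S v), W v) :=
  row_base (sub_space S v).

Definition sub_rep : rep :=
  @Rep (fun v => \rank (sub_space S v)) (fun a =>
    sub_inc_at (tail a) *m rep_map W a *m pinvmx (sub_inc_at (head a))).

(* A surjection of the space at v onto row vectors, with kernel the subspace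
   S v: its target is a model of the quotient by S v. *)
Definition quot_proj_at (v : vertex Q) :
    'M[k]_(W v, \rank (cokermx (sub_space S v))) :=
  col_base (cokermx (sub_space S v)).

Definition quot_rep : rep :=
  @Rep (fun v => \rank (cokermx (sub_space S v))) (fun a =>
    pinvmx (quot_proj_at (tail a)) *m rep_map W a *m quot_proj_at (head a)).

Lemma sub_inc_subproof a :
  rep_map sub_rep a *m sub_inc_at (head a) = sub_inc_at (tail a) *m rep_map W a.
Proof.
rewrite mulmxKpV // eq_row_base.
by apply: submx_trans (sub_stableP a); rewrite submxMr // eq_row_base.
Qed.

Definition sub_inc : hom sub_rep W := @mk_hom sub_rep W sub_inc_at sub_inc_subproof.

Lemma quot_proj_eq0 v m (A : 'M[k]_(m, W v)) :
  (A *m quot_proj_at v == 0) = (A <= sub_space S v)%MS.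
Proof.
rewrite submxE -[in RHS](mulmx_base (cokermx _)) mulmxA.
apply/eqP/eqP => [->|H]; first by rewrite mul0mx.
by apply: (row_free_inj (row_base_free (cokermx (sub_space S v)))); rewrite mul0mx.
Qed.

Lemma quot_proj_full v : row_full (quot_proj_at v).
Proof. exact: col_base_full. Qed.

Lemma quot_proj_subproof a :
  rep_map W a *m quot_proj_at (head a) = quot_proj_at (tail a) *m rep_map quot_rep a.
Proof.
suff : (rep_map W a - quot_proj_at (tail a) *m (pinvmx (quot_proj_at (tail a))
          *m rep_map W a)) *m quot_proj_at (head a) == 0.
  by rewrite mulmxBl subr_eq0 => /eqP ->; rewrite /= !mulmxA.
rewrite quot_proj_eq0 mulmxA -[X in (X - _)%R]mul1mx -mulmxBl.
apply: submx_trans (sub_stableP a); apply: submxMr.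
rewrite -quot_proj_eq0 mulmxBl mul1mx -mulmxA mulVpmx ?quot_proj_full //.
by rewrite mulmx1 subrr.
Qed.

Definition quot_proj : hom W quot_rep :=
  @mk_hom W quot_rep quot_proj_at quot_proj_subproof.

Lemma sub_quot_exact : short_exact sub_inc quot_proj.
Proof.
move=> v.
have -> : hom_at sub_inc v = sub_inc_at v by exact: mk_homE.
have -> : hom_at quot_proj v = quot_proj_at v by exact: mk_homE.
split; first exact: row_base_free; last exact: quot_proj_full.
apply/andP; split.
  by apply/sub_kermxP/eqP; rewrite quot_proj_eq0 eq_row_base.
by rewrite eq_row_base -quot_proj_eq0 mulmx_ker.
Qed.

End Subrepresentations.

(* F_{UV}^W: subrepresentations isomorphic to V with quotient isomorphic
   to U. *)
Definition hall_number (U V W : rep) : nat :=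
  #|[pred S : subrep W | isomorphic (sub_rep S) V && isomorphic (quot_rep S) U]|.

Lemma hall_number_finite (W : rep) :
  finite_set [set p : isoclass * isoclass |
    hall_number (class_repr p.1) (class_repr p.2) W != 0%N].
Proof.
have fin : finite_set
    ((fun S : subrep W => (class_of (quot_rep S), class_of (sub_rep S)))
       @` [set: subrep W]) by exact/finite_image/finite_finset.
apply: sub_finite_set fin => -[u v] /=.
rewrite -lt0n => /card_gt0P[S /andP[Sv Su]]; exists S => //.
by congr pair; rewrite -[RHS]class_reprK; apply/class_of_eq.
Qed.

Definition euler_form (al be : vertex Q -> nat) : int :=
  (\sum_(v : vertex Q) (al v)%:Z * (be v)%:Z)
  - (\sum_(a : arrow Q) (al (tail a))%:Z * (be (head a))%:Z).

End Representations.

Section HallAlgebra.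
Variables (R : realType) (k : finFieldType) (Q : quiver).

Definition mult_euler_form (al be : vertex Q -> nat) : R[i] :=
  (#|k|%:R : R[i]) ^ euler_form al be.

(* A formal, possibly infinite, linear combination of isomorphism classes is
   the family of its coefficients. The codomain is R[i]^o so that families form
   an R[i]-module; the Hall product is hall_mul, not the pointwise one. *)
Definition hall : Type := isoclass k Q -> R[i]^o.
HB.instance Definition _ :=
  GRing.Lmodule.copy hall (isoclass k Q -> R[i]^o).

Definition hall_basis (c : isoclass k Q) : hall := fun d => (d == c)%:R.

Definition hall_one : hall := hall_basis (class_of (rep0 k Q)).

(* For a given [W] only finitely many pairs ([U], [V]) contribute, by
   hall_number_finite. *)
Definition hall_mul (x y : hall) : hall := fun w =>
  \sum_(p \in [set: isoclass k Q * isoclass k Q])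
    x p.1 * y p.2 *
    (mult_euler_form (dimv (class_repr p.1)) (dimv (class_repr p.2)) *
     (hall_number (class_repr p.1) (class_repr p.2) (class_repr w))%:R).

Definition is_hall_subalgebra (D : set hall) : Prop :=
  [/\ D hall_one,
      forall (a : R[i]) x y, D x -> D y -> D (a *: x + y) &
      forall x y, D x -> D y -> D (hall_mul x y)].

End HallAlgebra.

Arguments hall_basis {R k Q}.
Arguments hall_one {R k Q}.
Arguments hall_mul {R k Q}.
Arguments is_hall_subalgebra {R k Q}.

Definition is_hall_morphism_on (R : realType) (k : finFieldType)
    (Q Q' : quiver) (D : set (hall R k Q)) (f : hall R k Q -> hall R k Q') :
    Prop :=
  [/\ f hall_one = hall_one,
      forall (a : R[i]) x y, D x -> D y -> f (a *: x + y) = a *: f x + f y &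
      forall x y, D x -> D y -> f (hall_mul x y) = hall_mul (f x) (f y)].

Record functor (k : finFieldType) (Q Q' : quiver) := Functor {
  fobj :> rep k Q -> rep k Q';
  fmap : forall M N : rep k Q, hom M N -> hom (fobj M) (fobj N);
  fmap_id : forall M, fmap (hom_id M) = hom_id (fobj M);
  fmap_comp : forall (M N P : rep k Q) (g : hom N P) (f : hom M N),
    fmap (hom_comp g f) = hom_comp (fmap g) (fmap f) }.

Section Functors.
Variables (k : finFieldType) (Q Q' : quiver) (F : functor k Q Q').

Lemma fmap_iso (M N : rep k Q) (f : hom M N) : is_iso f -> is_iso (fmap F f).
Proof.
move=> /is_isoP[g [gf fg]]; apply/is_isoP; exists (fmap F g).
by rewrite -!fmap_comp gf fg !fmap_id.
Qed.

Definition class_map (c : isoclass k Q) : isoclass k Q' :=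
  class_of (F (class_repr c)).

Lemma class_mapE (M : rep k Q) : class_map (class_of M) = class_of (F M).
Proof.
apply/class_of_eq/existsP.
have /class_of_eq/existsP[f fi] := class_reprK (class_of M).
by exists (fmap F f); exact: fmap_iso.
Qed.

Definition exact_functor : Prop :=
  forall (V E U : rep k Q) (i : hom V E) (p : hom E U),
    short_exact i p -> short_exact (fmap F i) (fmap F p).

Hypothesis Fexact : exact_functor.

Definition ext_image (U V : rep k Q) (e : extension U V) :
  extension (F U) (F V) := Extension (Fexact (ext_exact e)).

Definition ext_map (U V : rep k Q) (c : Ext U V) : Ext (F U) (F V) :=
  ext_class (ext_image (ext_repr c)).

Lemma ext_mapE (U V : rep k Q) (e : extension U V) :
  ext_map (ext_class e) = ext_class (ext_image e).
Proof.
apply/ext_class_eq/ext_equivP.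
have /ext_class_eq/ext_equivP[f [fi fl fr]] := ext_reprK (ext_class e).
exists (fmap F f); split; first exact: fmap_iso.
- by rewrite /= -fmap_comp fl.
- by rewrite /= -fmap_comp fr.
Qed.

Section Pushforward.
Variable R : realType.

(* F may send infinitely many isomorphism classes to the same one (the zero
   functor does), so the extension of [M] |-> a_{F(M)}/a_M [F(M)] to infinite
   formal combinations only makes sense when every coefficient of the image
   is a finite sum. *)
Definition hall_push_dom : set (hall R k Q) :=
  [set x | forall n, finite_set [set m | x m != 0 /\ class_map m = n]].

Definition hall_push (x : hall R k Q) : hall R k Q' := fun n =>
  \sum_(m \in [set m | class_map m = n])
    x m * ((aut_order (F (class_repr m)))%:R /
           (aut_order (class_repr m))%:R).

Lemma hall_push_dom_full :
  (forall n, finite_set [set m | class_map m = n]) -> hall_push_dom = setT.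
Proof.
move=> fin; apply/seteqP; split=> // x _ n.
by apply: sub_finite_set (fin n) => m [].
Qed.

Lemma hall_push_dom_basis c : hall_push_dom (hall_basis c).
Proof.
move=> n; apply: (@sub_finite_set _ _ [set c]); last exact: finite_set1.
move=> m [+ _]; rewrite /hall_basis; case: (m =P c) => //= _.
by rewrite eqxx.
Qed.

End Pushforward.
End Functors.

Arguments hall_push_dom {k Q Q'}.
Arguments hall_push {k Q Q'} F {R}.

(* Main.v *)
Require Import Defs.
From HB Require Import structures.
From mathcomp Require Import all_boot all_order all_algebra.
From mathcomp Require Import boolp classical_sets functions cardinality fsbigop.
From mathcomp Require Import reals.
From mathcomp Require Import complex.

Import Defs Order.TTheory GRing.Theory Num.Theory.
Local Open Scope card_scope.
Local Open Scope classical_set_scope.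
Local Open Scope ring_scope.

Set Implicit Arguments.
Unset Strict Implicit.
Unset Printing Implicit Defensive.

(** Rescale the basis by b_M := a_M [M]. The Hall product then averages over
extensions: b_U b_V is the mean of b_E over all extension classes E of U by V,
and the map of the theorem is simply b_M |-> b_(F M). A surjection with
equicardinal fibres pushes the uniform distribution on Ext(U, V) to the uniform
distribution on Ext(F U, F V), and the middle term of the image of an extension E
is F E; so the map is multiplicative on basis elements.

The averaging is not done over Ext(U, V) itself but over the finite vector space
of cocycles Z(U, V), the families z of matrices z_a : U(ta) -> V(ha) indexed by
the arrows. A cocycle z gives an extension E_z with space V + U at each vertex and
block triangular arrow maps, and z |-> class of E_z is onto Ext(U, V) with
equicardinal fibres ([cocycle_class_onto], [card_cocycle_fibre]); a uniform
cocycle thus gives a uniform extension class. The advantage is that the Euler form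
becomes elementary: <U, V> is the quotient of the number of families of matrices
U(v) -> V(v) indexed by the vertices by the number of cocycles, and neither Hom
nor Ext has to be counted.

For fixed W, the isomorphisms E_z -> W for varying z are counted in two ways
([card_cocycle_iso]). Grouped by z, there are a_W of them for each z with E_z
isomorphic to W. Grouped by the short exact sequence V -> W -> U that they induce,
there is one for each linear section of W -> U, and the number of sequences is
F_{UV}^W a_U a_V. Dividing, <U, V> F_{UV}^W a_U a_V / a_W is the probability
[ext_prob] that a random E_z is isomorphic to W ([hall_number_prob]), a form of
Riedtmann's formula.

For infinite combinations, a coefficient of a product or of an image only
involves finitely many classes, because a representation has finitely many
subrepresentations, F maps finitely many classes of the supports of x and y to a
given class, and U, V have finitely many extensions ([product_cover]). All the sums
become finite sums over lists, where they can be exchanged. *)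

(** * Counting and summation *)

Lemma card_in_bij (T T' : finType) (A : {pred T}) (B : {pred T'})
    (f : T -> T') :
    {in A &, injective f} -> {in A, forall x, f x \in B} ->
    (forall y, y \in B -> exists2 x, x \in A & f x = y) ->
  #|A| = #|B|.
Proof.
move=> finj fAB fsurj; rewrite -(card_in_image finj); apply: eq_card => y.
apply/fintype.imageP/idP => [[x xA ->]|/fsurj[x xA <-]]; first exact: fAB.
by exists x.
Qed.

(** If Z and Z' are nonempty, both maps push the uniform distribution of their source to
the uniform one on T, so P has the same probability on either side. To count without an enumeration of T, the
pairs (z, z') with h z = h' z' and P are counted by rows and by columns; taking P
true compares #|Z| with #|Z'|. *)
Lemma card_pred_of_equal_fibres (Z Z' : finType) (T : eqType) (h : Z -> T) (h' : Z' -> T)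
    (P : pred T) :
    (forall s t, #|[pred z | h z == s]| = #|[pred z | h z == t]|) ->
    (forall s t, #|[pred z | h' z == s]| = #|[pred z | h' z == t]|) ->
  (#|[pred z | P (h z)]| * #|Z'| = #|[pred z | P (h' z)]| * #|Z|)%N.
Proof.
move=> hfib hfib'.
have [z0|Z0] := pickP Z; last first.
  rewrite [in RHS](eq_card0 Z0) muln0; rewrite (@eq_card0 _ [pred z | P (h z)]) // => z.
  by have := Z0 z; rewrite !inE.
move=> _; pose t := h z0; pose a := #|[pred z | h z == t]|; pose b := #|[pred z | h' z == t]|.
have count (R : pred T) : (#|[pred z | R (h z)]| * b = #|[pred z | R (h' z)]| * a)%N.
  rewrite -!sum1_card !big_distrl /=.
  transitivity (\sum_(z | R (h z)) \sum_(z' | h' z' == h z) 1)%N.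
    by apply: eq_bigr => z _; rewrite mul1n [LHS](hfib' _ (h z)) -sum1_card; exact: eq_bigl.
  rewrite (exchange_big_dep (fun z' => R (h' z'))) /=; last by move=> z z' Rz /eqP ->.
  apply: eq_bigr => z' Rz'; rewrite mul1n [RHS](hfib _ (h' z')) -[RHS]sum1_card.
  apply: eq_bigl => z; rewrite inE eq_sym andb_idl // => /eqP zz'.
  by rewrite zz'.
have a0 : (0 < a)%N by apply/card_gt0P; exists z0; rewrite inE eqxx.
have all := count predT; have some := count P.
apply/eqP; rewrite -(eqn_pmul2r a0); apply/eqP.
rewrite -mulnA -[(#|Z'| * a)%N]all.
by rewrite mulnCA some mulnCA mulnA.
Qed.

(** An equipotence between subsets gives a bijection between subtypes; here it is
extended to the whole type, and t0 provides a value outside A. *)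
Lemma card_eq_inj (S T : Type) (A : set S) (B : set T) (t0 : T) :
  (A #= B)%card ->
  exists2 f : S -> T, forall x, A x -> B (f x)
    & forall x y, A x -> A y -> f x = f y -> x = y.
Proof.
elim/Ppointed: T => T in B t0 *; first by case: (no t0).
move=> /card_set_bijP[f [fAB finj _]]; exists f => // x y Ax Ay fxy.
by apply: finj => //; rewrite in_setE.
Qed.

(** Sums over sets are carried over to lists by this lemma, for the operations that
need finite ranges: exchange of sums and distributivity. *)
Lemma fsum_seq (A : zmodType) (T : choiceType) (D : set T) (P : pred T) (r : seq T)
    (f : T -> A) :
    uniq r -> (forall i, D i <-> P i) -> (forall i, D i -> f i != 0 -> i \in r) ->
  \sum_(i \in D) f i = \sum_(i <- r | P i) f i.
Proof.
move=> ur DP fr; rewrite [RHS]bigfs //.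
  by suff -> : D = [set` P] by []; apply/seteqP; split=> i /DP.
by move=> i Pi; apply: contraNeq => /fr; apply; apply/DP.
Qed.

(** * Homomorphisms and isomorphisms of representations *)

Section Isomorphisms.
Variables (k : finFieldType) (Q : quiver).
Implicit Types U V W M N P : rep k Q.

Lemma hom_comp_at M N P (g : hom N P) (f : hom M N) v :
  hom_at (hom_comp g f) v = hom_at f v *m hom_at g v.
Proof. exact: mk_homE. Qed.

Lemma hom_id_at M v : hom_at (hom_id M) v = 1%:M.
Proof. exact: mk_homE. Qed.

Lemma mono_cancel M N P (j : hom N P) (f g : hom M N) :
    (forall v, row_free (hom_at j v)) ->
  hom_comp j f = hom_comp j g -> f = g.
Proof.
move=> jfree jfg; apply: hom_ext => v; apply: (row_free_inj (jfree v)).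
by rewrite -!hom_comp_at jfg.
Qed.

Lemma epi_cancel M N P (q : hom M N) (f g : hom N P) :
    (forall v, row_full (hom_at q v)) ->
  hom_comp f q = hom_comp g q -> f = g.
Proof.
move=> qfull fgq; apply: hom_ext => v; apply: (row_full_inj (qfull v)).
by rewrite -!hom_comp_at fgq.
Qed.

Lemma iso_free M N (f : hom M N) v : is_iso f -> row_free (hom_at f v).
Proof.
move=> /is_isoP[g [gf _]]; apply/row_freeP; exists (hom_at g v).
by rewrite -hom_comp_at gf hom_id_at.
Qed.

Lemma iso_full M N (f : hom M N) v : is_iso f -> row_full (hom_at f v).
Proof.
move=> /is_isoP[g [_ fg]]; apply/row_fullP; exists (hom_at g v).
by rewrite -hom_comp_at fg hom_id_at.
Qed.

(** The factorisation through j exists vertex by vertex as soon as j contains the image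
of i, and it commutes with the arrows because j can be cancelled. *)
Lemma hom_lift M N W (j : hom N W) (i : hom M W) :
    (forall v, row_free (hom_at j v)) ->
    (forall v, (hom_at i v <= hom_at j v)%MS) ->
  exists f : hom M N, hom_comp j f = i.
Proof.
move=> jfree ij.
have fj v : hom_at i v *m pinvmx (hom_at j v) *m hom_at j v = hom_at i v.
  exact: mulmxKpV.
have fc a : rep_map M a *m (hom_at i (head a) *m pinvmx (hom_at j (head a))) =
    hom_at i (tail a) *m pinvmx (hom_at j (tail a)) *m rep_map N a.
  apply: (row_free_inj (jfree (head a))).
  by rewrite /= -[LHS]mulmxA fj -[RHS]mulmxA !hom_atP mulmxA fj.
exists (@mk_hom _ _ _ _ (fun v => hom_at i v *m pinvmx (hom_at j v)) fc); apply: hom_ext => v.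
by rewrite hom_comp_at mk_homE fj.
Qed.

Lemma hom_desc W M N (q : hom W M) (p : hom W N) :
    (forall v, row_full (hom_at q v)) ->
    (forall v, (kermx (hom_at q v) <= kermx (hom_at p v))%MS) ->
  exists g : hom M N, hom_comp g q = p.
Proof.
move=> qfull qp.
have gq v : hom_at q v *m (pinvmx (hom_at q v) *m hom_at p v) = hom_at p v.
  apply/eqP; rewrite mulmxA -subr_eq0 -[X in _ - X]mul1mx -mulmxBl.
  apply/eqP/sub_kermxP; apply: submx_trans (qp v); apply/sub_kermxP.
  by rewrite mulmxBl mul1mx -mulmxA mulVpmx // mulmx1 subrr.
have gc a : rep_map M a *m (pinvmx (hom_at q (head a)) *m hom_at p (head a)) =
    pinvmx (hom_at q (tail a)) *m hom_at p (tail a) *m rep_map N a.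
  apply: (row_full_inj (qfull (tail a))).
  by rewrite /= [LHS]mulmxA -[X in X *m _]hom_atP -[LHS]mulmxA gq [RHS]mulmxA gq hom_atP.
exists (@mk_hom _ _ _ _ (fun v => pinvmx (hom_at q v) *m hom_at p v) gc); apply: hom_ext => v.
by rewrite hom_comp_at mk_homE gq.
Qed.

(** Two subobjects with the same image factor through each other, and the two factors are
inverse to each other by cancellation. *)
Lemma lift_iso M N W (j : hom N W) (i : hom M W) :
    (forall v, row_free (hom_at i v)) -> (forall v, row_free (hom_at j v)) ->
    (forall v, (hom_at i v == hom_at j v)%MS) ->
  exists2 f : hom M N, is_iso f & hom_comp j f = i.
Proof.
move=> ifree jfree ij.
have [v|f jf] := @hom_lift _ _ _ j i jfree; first by case/andP: (ij v).
have [v|g ig] := @hom_lift _ _ _ i j ifree; first by case/andP: (ij v).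
exists f => //; apply/is_isoP; exists g; split.
  by apply: (mono_cancel ifree); rewrite hom_compA ig jf hom_comp1r.
by apply: (mono_cancel jfree); rewrite hom_compA jf ig hom_comp1r.
Qed.

Lemma iso_of_bijective M N (f : hom M N) :
    (forall v, row_free (hom_at f v)) -> (forall v, row_full (hom_at f v)) ->
  is_iso f.
Proof.
move=> ffree ffull.
have [//|v|v|g gi <-] := @lift_iso _ _ _ (hom_id N) f.
- by rewrite hom_id_at row_free_unit unitmx1.
- by apply/eqmxP; rewrite hom_id_at; apply/eqmxP; rewrite submx1 sub1mx ffull.
by rewrite hom_comp1l.
Qed.

Lemma desc_iso W M N (q : hom W M) (p : hom W N) :
    (forall v, row_full (hom_at q v)) -> (forall v, row_full (hom_at p v)) ->
    (forall v, (kermx (hom_at q v) == kermx (hom_at p v))%MS) ->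
  exists2 g : hom M N, is_iso g & hom_comp g q = p.
Proof.
move=> qfull pfull qp.
have [v|g gq] := @hom_desc _ _ _ q p qfull; first by case/andP: (qp v).
have [v|f fp] := @hom_desc _ _ _ p q pfull; first by case/andP: (qp v).
exists g => //; apply/is_isoP; exists f; split.
  by apply: (epi_cancel qfull); rewrite -hom_compA gq fp hom_comp1l.
by apply: (epi_cancel pfull); rewrite -hom_compA fp gq hom_comp1l.
Qed.

(** Composition with one isomorphism M -> N identifies all of them with the automorphisms
of N. *)
Lemma card_iso M N :
  #|[pred f : hom M N | is_iso f]| = (isomorphic M N * aut_order N)%N.
Proof.
case: (boolP (isomorphic M N)) => [/existsP[h hi]|noniso]; last first.
  rewrite mul0n; apply: eq_card0 => f; rewrite !inE.
  by apply: contraNF noniso => fi; apply/existsP; exists f.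
rewrite mul1n; apply/esym.
apply: (@card_in_bij _ _ _ _ (fun g : hom N N => hom_comp g h)).
- by move=> g g' _ _; apply: epi_cancel => v; exact: iso_full.
- by move=> g; rewrite !inE => gi; exact: is_iso_comp.
move=> f; rewrite inE => fi.
have /is_isoP[h' [h'h hh']] := hi.
exists (hom_comp f h'); last by rewrite -hom_compA h'h hom_comp1r.
by rewrite inE is_iso_comp //; apply/is_isoP; exists h.
Qed.

Lemma aut_order_iso M N : isomorphic M N -> aut_order M = aut_order N.
Proof.
move=> MN; have := card_iso M N; rewrite MN mul1n => <-.
rewrite /aut_order.
have /existsP[h hi] := MN.
apply: (@card_in_bij _ _ _ _ (fun g : hom M M => hom_comp h g)).
- by move=> g g' _ _; apply: mono_cancel => v; exact: iso_free.
- by move=> g; rewrite !inE => gi; exact: is_iso_comp.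
move=> f; rewrite inE => fi.
have /is_isoP[h' [h'h hh']] := hi.
exists (hom_comp h' f); last by rewrite hom_compA hh' hom_comp1l.
by rewrite inE is_iso_comp //; apply/is_isoP; exists h.
Qed.

Lemma aut_order_gt0 M : (0 < aut_order M)%N.
Proof. by apply/card_gt0P; exists (hom_id M); rewrite inE is_iso_id. Qed.

Lemma isomorphic_dim M N v : isomorphic M N -> M v = N v.
Proof.
move=> /existsP[f fi]; have := iso_free v fi; have := iso_full v fi.
by rewrite /row_free /row_full => /eqP fN /eqP fM; rewrite -[LHS]fM.
Qed.

Lemma isomorphicl M N W : isomorphic M N -> isomorphic M W = isomorphic N W.
Proof.
move=> MN; apply/idP/idP; apply: isomorphic_trans => //.
by rewrite isomorphic_sym.
Qed.

Lemma isomorphicr M N W : isomorphic M N -> isomorphic W M = isomorphic W N.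
Proof. by move=> /(@isomorphicl _ _ W); rewrite ![isomorphic W _]isomorphic_sym. Qed.

(** * Short exact sequences and Hall numbers *)

(** The boolean form makes the set of exact pairs a finite set that can be counted. *)
Definition exactb V W U (i : hom V W) (p : hom W U) : bool :=
  [forall v, [&& row_free (hom_at i v), (hom_at i v == kermx (hom_at p v))%MS
     & row_full (hom_at p v)]].

Lemma exactbP V W U (i : hom V W) (p : hom W U) :
  reflect (short_exact i p) (exactb i p).
Proof.
by apply: (iffP forallP) => ip v; [have /and3P[] := ip v | apply/and3P; case: (ip v)].
Qed.

Lemma short_exact_iso V V' W U U' (f : hom V' V) (i : hom V W) (p : hom W U)
    (g : hom U U') :
  is_iso f -> is_iso g -> short_exact i p ->
  short_exact (hom_comp i f) (hom_comp g p).
Proof.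
move=> fi gi ip v; have [ifree ikp pfull] := ip v; rewrite !hom_comp_at; split.
- have /row_freeP[B fB] := iso_free v fi; have /row_freeP[C iC] := ifree.
  by apply/row_freeP; exists (C *m B); rewrite mulmxA -[_ *m _ *m C]mulmxA iC mulmx1.
- apply/eqmxP/(eqmx_trans (eqmxMfull _ (iso_full v fi))).
  apply/(eqmx_trans (eqmxP ikp)); have gfree := iso_free v gi.
  apply/eqmxP/andP; split; apply/sub_kermxP; first by rewrite mulmxA mulmx_ker mul0mx.
  by apply: (row_free_inj gfree); rewrite -mulmxA mulmx_ker mul0mx.
have /row_fullP[B Bg] := iso_full v gi; have /row_fullP[C Cp] := pfull.
by apply/row_fullP; exists (B *m C); rewrite mulmxA -[_ *m _ *m hom_at p v]mulmxA Cp mulmx1.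
Qed.

Lemma short_exact_iso_mid V W W' U (i : hom V W) (p : hom W U) (g : hom W W')
    (g' : hom W' W) :
  hom_comp g' g = hom_id W -> hom_comp g g' = hom_id W' -> short_exact i p ->
  short_exact (hom_comp g i) (hom_comp p g').
Proof.
move=> g'g gg' ip v; have [ifree /andP[ikp kpi] pfull] := ip v.
have gg'1 : hom_at g v *m hom_at g' v = 1%:M by rewrite -hom_comp_at g'g hom_id_at.
have g'g1 : hom_at g' v *m hom_at g v = 1%:M by rewrite -hom_comp_at gg' hom_id_at.
rewrite !hom_comp_at; split.
- have /row_freeP[C iC] := ifree; apply/row_freeP; exists (hom_at g' v *m C).
  by rewrite mulmxA -(mulmxA (hom_at i v)) gg'1 mulmx1.
- apply/andP; split.
    apply/sub_kermxP; rewrite mulmxA -(mulmxA (hom_at i v)) gg'1 mulmx1.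
    exact/sub_kermxP.
  rewrite -[kermx _]mulmx1 -g'g1 mulmxA submxMr //; apply: submx_trans kpi.
  by apply/sub_kermxP; rewrite -mulmxA mulmx_ker.
have /row_fullP[C Cp] := pfull; apply/row_fullP; exists (C *m hom_at g v).
by rewrite mulmxA -(mulmxA C) gg'1 mulmx1.
Qed.

Lemma image_sub_stable V W (i : hom V W) :
  stable [ffun v => <<hom_at i v>>%MS].
Proof.
apply/andP; split; apply/forallP => a; rewrite !ffunE ?genmx_id //.
by rewrite !genmxE (eqmxMr _ (genmxE _)) -hom_atP submxMl.
Qed.

(** Row spaces are made canonical by <<_>>, as in the definition of subrepresentations, so
that equality of images is equality in the type of subrepresentations. *)
Definition image_sub V W (i : hom V W) : subrep W := Subrep (image_sub_stable i).

Lemma image_subP V W (i : hom V W) (S : subrep W) :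
  reflect (forall v, (hom_at i v == sub_space S v)%MS) (image_sub i == S).
Proof.
apply: (iffP eqP) => [<- v|iS]; first by rewrite /= ffunE; apply/eqmxP/eqmx_sym/genmxE.
apply/val_inj/ffunP => v; rewrite /= ffunE.
by have /andP[/forallP/(_ v)/eqP <- _] := sub_stable S; apply/genmxP.
Qed.

(** A sequence V -> W -> U whose first map has image S is the canonical sequence of S and
its quotient, up to unique isomorphisms at the two ends. *)
Lemma exact_factor_sub U V W (S : subrep W) (i : hom V W) (p : hom W U) :
  exactb i p -> image_sub i = S ->
  exists f g, [/\ is_iso f, is_iso g, i = hom_comp (sub_inc S) f &
                   p = hom_comp g (quot_proj S)].
Proof.
move=> /exactbP ip /eqP/image_subP iS; have SE := sub_quot_exact S.
have inc_at v : hom_at (sub_inc S) v = sub_inc_at S v by exact: mk_homE.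
have iinc v : (hom_at i v == hom_at (sub_inc S) v)%MS.
  rewrite inc_at; apply/eqmxP/(eqmx_trans (eqmxP (iS v)))/eqmx_sym.
  exact: eq_row_base.
have kerqp v : (kermx (hom_at (quot_proj S) v) == kermx (hom_at p v))%MS.
  have [_ /eqmxP Sq _] := SE v; have [_ /eqmxP ikp _] := ip v.
  apply/eqmxP/(eqmx_trans (eqmx_sym Sq)).
  exact: (eqmx_trans (eqmx_sym (eqmxP (iinc v)))).
have [||//|f fi fE] := @lift_iso _ _ _ (sub_inc S) i.
- by move=> v; case: (ip v).
- by move=> v; case: (SE v).
have [||//|g gi gE] := @desc_iso _ _ _ (quot_proj S) p.
- by move=> v; case: (SE v).
- by move=> v; case: (ip v).
by exists f, g.
Qed.

(** Partition the exact pairs by the image S of the first map: those over a given S are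
the choices of an isomorphism of V with S and of one of W/S with U. *)
Lemma card_exact_pairs U V W :
  #|[pred ip : hom V W * hom W U | exactb ip.1 ip.2]| =
  (hall_number U V W * (aut_order U * aut_order V))%N.
Proof.
rewrite /hall_number -[LHS]sum1_card -[X in (X * _)%N]sum1_card big_distrl /=.
rewrite (partition_big (fun ip : hom V W * hom W U => image_sub ip.1) predT) //=.
rewrite [RHS]big_mkcond /=; apply: eq_bigr => S _.
rewrite sum1dep_card.
pose glue (fg : hom V (sub_rep S) * hom (quot_rep S) U) :=
  (hom_comp (sub_inc S) fg.1, hom_comp fg.2 (quot_proj S)).
have SE := sub_quot_exact S.
rewrite -(@card_in_bij _ _ [predX [pred f | is_iso f] & [pred g | is_iso g]] _ glue).
- rewrite cardX !card_iso [isomorphic V _]isomorphic_sym inE.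
  case: (boolP (isomorphic (sub_rep S) V)) => [SV|]; last by rewrite mul0n.
  case: (boolP (isomorphic (quot_rep S) U)) => [SU|]; last by rewrite mul0n muln0.
  by rewrite (aut_order_iso SV) !mul1n mulnC.
- move=> [f g] [f' g'] _ _ fg; congr pair.
    by apply: mono_cancel (congr1 fst fg) => v; case: (SE v).
  by apply: epi_cancel (congr1 snd fg) => v; case: (SE v).
- move=> [f g] /=; rewrite !inE /= => /andP[fi gi].
  apply/andP; split; first by apply/exactbP; exact: short_exact_iso.
  apply/image_subP => v; rewrite hom_comp_at mk_homE; apply/eqmxP.
  exact: (eqmx_trans (eqmxMfull _ (iso_full v fi)) (eq_row_base _)).
move=> [i p]; rewrite !inE /= => /andP[ip /eqP iS].
have [f [g [fi gi -> ->]]] := exact_factor_sub ip iS.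
by exists (f, g); rewrite // inE /= !inE fi gi.
Qed.
End Isomorphisms.

(** * Extensions given by cocycles *)

Section Cocycles.
Variables (k : finFieldType) (Q : quiver) (U V : rep k Q).

(** The term of degree 0 in the complex that computes Hom(U, V) and Ext(U, V); its term of
degree 1 is [cocycle]. The differential sends f to U_a f(ha) - f(ta) V_a. *)
Definition cochain := {dffun forall v, 'M[k]_(U v, V v)}.
Definition cocycle := {dffun forall a, 'M[k]_(U (tail a), V (head a))}.

Lemma card_cochain : #|{: cochain}| = (#|k| ^ \sum_(v : vertex Q) U v * V v)%N.
Proof.
rewrite card_dep_ffun expn_sum foldrE big_map big_enum /=.
by apply: eq_bigr => v _; rewrite card_mx.
Qed.

Lemma card_cocycle :
  #|{: cocycle}| = (#|k| ^ \sum_(a : arrow Q) U (tail a) * V (head a))%N.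
Proof.
rewrite card_dep_ffun expn_sum foldrE big_map big_enum /=.
by apply: eq_bigr => v _; rewrite card_mx.
Qed.

Lemma card_cocycle_gt0 : (0 < #|{: cocycle}|)%N.
Proof. by apply/card_gt0P; exists [ffun => 0]. Qed.

(** Vectors at v are pairs in V(v) + U(v), in this order; since matrices act on the right,
the block below the diagonal sends the U part of a vector to the V part of its image. *)
Definition cocycle_rep (z : cocycle) : rep k Q :=
  @Rep k Q (fun v => V v + U v)%N
    (fun a => block_mx (rep_map V a) 0 (z a) (rep_map U a)).

Definition cocycle_inc_at v : 'M[k]_(V v, V v + U v) := row_mx 1%:M 0.
Definition cocycle_proj_at v : 'M[k]_(V v + U v, U v) := col_mx 0 1%:M.

Lemma cocycle_inc_subproof z a :
  rep_map V a *m cocycle_inc_at (head a) =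
  cocycle_inc_at (tail a) *m rep_map (cocycle_rep z) a.
Proof. by rewrite /= mul_mx_row mul_row_block !mul1mx !mul0mx mulmx1 mulmx0 !addr0. Qed.

Lemma cocycle_proj_subproof z a :
  rep_map (cocycle_rep z) a *m cocycle_proj_at (head a) =
  cocycle_proj_at (tail a) *m rep_map U a.
Proof.
rewrite /= /cocycle_proj_at mul_block_col mul_col_mx.
by rewrite !mulmx1 !mul0mx !mulmx0 mul1mx !add0r.
Qed.

Definition cocycle_inc z : hom V (cocycle_rep z) :=
  @mk_hom _ _ V (cocycle_rep z) cocycle_inc_at (cocycle_inc_subproof z).
Definition cocycle_proj z : hom (cocycle_rep z) U :=
  @mk_hom _ _ (cocycle_rep z) U cocycle_proj_at (cocycle_proj_subproof z).

Lemma cocycle_exact z : short_exact (cocycle_inc z) (cocycle_proj z).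
Proof.
move=> v; rewrite !mk_homE; split.
- by apply/row_freeP; exists (col_mx 1%:M 0); rewrite mul_row_col mul0mx addr0 mul1mx.
- apply/andP; split.
    by apply/sub_kermxP; rewrite mul_row_col mulmx0 mul0mx addr0.
  apply/rV_subP => x /sub_kermxP; rewrite -[x]hsubmxK mul_row_col mulmx0 add0r mulmx1.
  by move=> ->; apply/submxP; exists (lsubmx x); rewrite mul_mx_row mulmx1 mulmx0.
by apply/row_fullP; exists (row_mx 0 1%:M); rewrite mul_row_col mul0mx add0r mul1mx.
Qed.

Definition cocycle_ext z : extension U V := Extension (cocycle_exact z).

(** * Counting cocycles by middle term *)

Section Equivalences.
Variables (W : rep k Q) (i : hom V W) (p : hom W U).
Hypothesis ip : short_exact i p.

Definition equivs z : simpl_pred (hom (cocycle_rep z) W) :=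
  [pred g | [&& is_iso g, hom_comp g (cocycle_inc z) == i
                        & hom_comp p g == cocycle_proj z]].

Let ifree v : row_free (hom_at i v). Proof. by case: (ip v). Qed.
Let pfull v : row_full (hom_at p v). Proof. by case: (ip v). Qed.
Let ip0 v : hom_at i v *m hom_at p v = 0.
Proof. by apply/sub_kermxP; case: (ip v) => _ /andP[]. Qed.
Let ker_i v m (A : 'M[k]_(m, W v)) : A *m hom_at p v = 0 ->
  A *m pinvmx (hom_at i v) *m hom_at i v = A.
Proof.
move=> Ap; apply: mulmxKpV; apply: (submx_trans (B := kermx (hom_at p v))).
  exact/sub_kermxP.
by case: (ip v) => _ /andP[].
Qed.

(** Linear sections of p at the vertices form a torsor under the cochains; the
pseudo-inverse of p is the section taken as origin. *)
Definition section_of (f : cochain) v : 'M[k]_(U v, W v) :=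
  pinvmx (hom_at p v) + f v *m hom_at i v.

(** The defect of a linear section s to commute with the arrows, s(ta) W_a - U_a s(ha),
is killed by p, hence takes its values in the image of i; pulled back to V it is a
cocycle. *)
Definition cocycle_of (f : cochain) : cocycle :=
  [ffun a => (section_of f (tail a) *m rep_map W a -
              rep_map U a *m section_of f (head a)) *m pinvmx (hom_at i (head a))].

Lemma section_ofP f v : section_of f v *m hom_at p v = 1%:M.
Proof. by rewrite mulmxDl mulVpmx // -mulmxA ip0 mulmx0 addr0. Qed.

(** The coordinate, in the torsor of sections, of the restriction of g to the summand
U. *)
Definition cochain_of z (g : hom (cocycle_rep z) W) : cochain :=
  [ffun v => (dsubmx (hom_at g v) - pinvmx (hom_at p v)) *m pinvmx (hom_at i v)].

Lemma equiv_inc z (g : hom (cocycle_rep z) W) v :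
  g \in equivs z -> usubmx (hom_at g v) = hom_at i v.
Proof.
move=> /and3P[_ /eqP <- _]; rewrite hom_comp_at mk_homE -[X in _ = _ *m X]vsubmxK.
by rewrite mul_row_col mul1mx mul0mx addr0.
Qed.

Lemma equiv_section z (g : hom (cocycle_rep z) W) v :
  g \in equivs z -> dsubmx (hom_at g v) = section_of (cochain_of g) v.
Proof.
move=> /and3P[_ _ /eqP gp].
have : dsubmx (hom_at g v) *m hom_at p v = 1%:M.
  have := congr1 (fun h : hom (cocycle_rep z) U => dsubmx (hom_at h v)) gp.
  rewrite hom_comp_at mk_homE col_mxKd => <-.
  by rewrite -[X in _ = dsubmx (X *m _)]vsubmxK mul_col_mx col_mxKd.
move=> sp; rewrite /section_of ffunE ker_i; first by rewrite addrC subrK.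
by rewrite mulmxBl sp mulVpmx // subrr.
Qed.

Lemma equivE z (g : hom (cocycle_rep z) W) v :
  g \in equivs z -> hom_at g v = col_mx (hom_at i v) (section_of (cochain_of g) v).
Proof. by move=> gz; rewrite -(equiv_inc v gz) -equiv_section // vsubmxK. Qed.

Lemma equiv_cocycle z (g : hom (cocycle_rep z) W) :
  g \in equivs z -> cocycle_of (cochain_of g) = z.
Proof.
move=> gz; apply/ffunP => a; rewrite ffunE.
have /(congr1 dsubmx) := hom_atP g a.
rewrite !(equivE _ gz) /= mul_block_col !mul_col_mx !col_mxKd => <-.
by rewrite addrK -mulmxA mulmxVp // mulmx1.
Qed.

(** Every section s is reached: the map V + U -> W given by i and s is bijective with an
explicit inverse, and it commutes with the arrows for the cocycle of s by
construction. *)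
Lemma equiv_of_cochain f :
  exists2 g, g \in equivs (cocycle_of f) & cochain_of g = f.
Proof.
pose s := section_of f; pose z := cocycle_of f.
have gc a : rep_map (cocycle_rep z) a *m col_mx (hom_at i (head a)) (s (head a)) =
    col_mx (hom_at i (tail a)) (s (tail a)) *m rep_map W a.
  rewrite /= mul_block_col mul_col_mx mul0mx addr0 hom_atP ffunE ker_i ?subrK //.
  by rewrite mulmxBl -!mulmxA hom_atP section_ofP mulmxA section_ofP mul1mx mulmx1 subrr.
pose g := @mk_hom _ _ (cocycle_rep z) W (fun v => col_mx (hom_at i v) (s v)) gc.
exists g; last first.
  apply/ffunP => v; rewrite ffunE mk_homE col_mxKd /s /section_of addrC addKr.
  by rewrite -mulmxA mulmxVp // mulmx1.
rewrite inE; apply/and3P; split.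
  (* The inverse sends w to the pair of (w - s (p w)), pulled back along i, and p w. *)
- apply: iso_of_bijective => v; rewrite mk_homE.
    apply/row_freeP; exists (row_mx ((1%:M - hom_at p v *m s v) *m pinvmx (hom_at i v))
      (hom_at p v)).
    rewrite mul_col_row [hom_at i v *m (_ *m pinvmx _)]mulmxA.
    rewrite mulmxBr mulmx1 [hom_at i v *m (_ *m s v)]mulmxA.
    rewrite ip0 mul0mx subr0 mulmxVp // [s v *m (_ *m pinvmx _)]mulmxA.
    rewrite mulmxBr mulmx1 [s v *m (_ *m s v)]mulmxA section_ofP mul1mx subrr mul0mx.
    exact: esym (scalar_mx_block _ _ _).
  apply/row_fullP; exists (row_mx ((1%:M - hom_at p v *m s v) *m pinvmx (hom_at i v))
      (hom_at p v)).
  rewrite mul_row_col ker_i ?subrK // mulmxBl mul1mx -mulmxA section_ofP.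
  by rewrite mulmx1 subrr.
- apply/eqP/hom_ext => v; rewrite hom_comp_at !mk_homE.
  by rewrite mul_row_col mul1mx mul0mx addr0.
apply/eqP/hom_ext => v; rewrite hom_comp_at !mk_homE.
by rewrite mul_col_mx ip0 section_ofP.
Qed.

(** An equivalence from some E_z is i on V and a linear section of p on U. The section is
arbitrary and determines z, so the equivalences for all z together correspond to the
sections, that is, to the cochains. *)
Lemma sum_card_equivs : (\sum_(z : cocycle) #|equivs z| = #|{: cochain}|)%N.
Proof.
rewrite -[RHS]sum1_card (partition_big cocycle_of predT) //=.
apply: eq_bigr => z _; rewrite sum1dep_card.
apply: (@card_in_bij _ _ _ _ (@cochain_of z)).
- move=> g g' gz g'z gg'; apply: hom_ext => v; rewrite (equivE v gz) (equivE v g'z).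
  by rewrite gg'.
- by move=> g gz; rewrite inE; apply/eqP/equiv_cocycle.
by move=> f; rewrite inE => /eqP <-; exact: equiv_of_cochain.
Qed.
End Equivalences.
End Cocycles.

Section ExtensionCounting.
Variables (k : finFieldType) (Q : quiver).
Implicit Types U V W : rep k Q.

(** Both sides count the isomorphisms E_z -> W for all z together: on the left by z; on the
right by the exact pair that such an isomorphism transports to W, each pair being
obtained from as many isomorphisms as there are cochains. *)
Lemma card_cocycle_iso U V W :
  (#|[pred z : cocycle U V | isomorphic (cocycle_rep z) W]| * aut_order W =
   #|{: cochain U V}| * (hall_number U V W * (aut_order U * aut_order V)))%N.
Proof.
transitivity (\sum_(z : cocycle U V) \sum_(ip : hom V W * hom W U | exactb ip.1 ip.2)
    #|equivs ip.1 ip.2 z|)%N; last first.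
  rewrite exchange_big /= -card_exact_pairs mulnC -sum_nat_const.
  by apply: eq_bigr => -[i p] /exactbP ip; exact: sum_card_equivs.
rewrite -sum1_card big_distrl big_mkcond /=; apply: eq_bigr => z _.
transitivity #|[pred g : hom (cocycle_rep z) W | is_iso g]|.
  by rewrite card_iso inE; case: isomorphic; rewrite ?mul1n.
rewrite -sum1_card; apply/esym; under eq_bigr do rewrite -sum1_card.
rewrite (exchange_big_dep (fun g : hom (cocycle_rep z) W => is_iso g)) /=; last first.
  by move=> ip g _ /and3P[].
apply: eq_bigr => g gi; have /is_isoP[g' [g'g gg']] := gi.
(* g is an equivalence for the exact pair transported along g, and for no other. *)
rewrite (big_pred1 (hom_comp g (cocycle_inc z), hom_comp (cocycle_proj z) g')) //.
move=> [i p] /=; rewrite inE gi /= xpair_eqE; apply/idP/idP.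
  move=> /and3P[_ /eqP <- /eqP <-]; rewrite eqxx /=.
  by rewrite -hom_compA gg' hom_comp1r.
move=> /andP[/eqP -> /eqP ->]; rewrite -hom_compA g'g hom_comp1r !eqxx !andbT.
by apply/exactbP; apply: short_exact_iso_mid => //; exact: cocycle_exact.
Qed.

(** * The map from cocycles to extension classes *)

(** Equivalences of extensions are unipotent block matrices, and the block f below the
diagonal is a cochain whose differential is the difference of the two cocycles. So the
fibres of z |-> class of E_z are cosets of the coboundaries. *)
Lemma cocycle_ext_equivP U V (z z' : cocycle U V) :
  ext_equiv (cocycle_ext z) (cocycle_ext z') <->
  exists f : cochain U V, forall a,
    z a + rep_map U a *m f (head a) = f (tail a) *m rep_map V a + z' a.
Proof.
split.
  move=> /ext_equivP[g [gi gl gr]].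
  have gz : g \in equivs (cocycle_inc z') (cocycle_proj z') z.
    by rewrite inE gi gl gr !eqxx.
  pose f : cochain U V := [ffun v => lsubmx (dsubmx (hom_at g v))].
  have gE v : hom_at g v = block_mx 1%:M 0 (f v) 1%:M.
    rewrite (equivE (cocycle_exact z') v gz) mk_homE ffunE /block_mx; congr col_mx.
    rewrite -(equiv_section (cocycle_exact z') v gz) -[LHS]hsubmxK; congr row_mx.
    have := section_ofP (cocycle_exact z') (cochain_of (cocycle_inc z') (cocycle_proj z') g) v.
    rewrite -(equiv_section (cocycle_exact z') v gz) mk_homE -[X in X *m _]hsubmxK.
    by rewrite mul_row_col mulmx0 add0r mulmx1.
  exists f => a; have := hom_atP g a; rewrite /= !gE !mulmx_block.
  rewrite !mulmx1 !mul1mx => /(congr1 dlsubmx).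
  by rewrite !block_mxKdl.
move=> [f fz].
pose gv v : 'M[k]_(cocycle_rep z v, cocycle_rep z' v) := block_mx 1%:M 0 (f v) 1%:M.
have gc a : rep_map (cocycle_rep z) a *m gv (head a) =
    gv (tail a) *m rep_map (cocycle_rep z') a.
  rewrite /= !mulmx_block !mulmx1 !mul1mx !mul0mx !mulmx0 !addr0 !add0r.
  by rewrite fz.
apply/ext_equivP; exists (mk_hom gc); split.
- have gu v : gv v \in unitmx by rewrite unitmxE det_lblock !det1 mulr1 unitr1.
  by apply: iso_of_bijective => v; rewrite mk_homE ?row_free_unit ?row_full_unit gu.
- apply: hom_ext => v; rewrite hom_comp_at !mk_homE /gv mul_row_block.
  by rewrite !mul1mx !mul0mx !addr0.
apply: hom_ext => v; rewrite hom_comp_at !mk_homE /gv mul_block_col.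
by rewrite !mulmx1 !mulmx0 !add0r.
Qed.

Definition cocycle_class U V (z : cocycle U V) : Ext U V := ext_class (cocycle_ext z).

(** Any linear section of an extension exhibits it as some E_z. *)
Lemma cocycle_class_onto U V (c : Ext U V) : exists z, cocycle_class z = c.
Proof.
pose f0 : cochain U V := [ffun => 0].
have [g /and3P[gi /eqP gl /eqP gr] _] := equiv_of_cochain (ext_exact (ext_repr c)) f0.
exists (cocycle_of (ext_inc (ext_repr c)) (ext_proj (ext_repr c)) f0).
rewrite -[RHS]ext_reprK; apply/ext_class_eq/ext_equivP.
by exists g.
Qed.

Definition translate U V (z z' w : cocycle U V) : cocycle U V :=
  [ffun a => z a - z' a + w a].

Lemma translateK U V (z z' w : cocycle U V) :
  translate (translate z z' w) w z' = z.
Proof. by apply/ffunP => a; rewrite !ffunE addrK subrK. Qed.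

Lemma class_translate U V (z z' w : cocycle U V) :
  cocycle_class z = cocycle_class z' ->
  cocycle_class (translate z z' w) = cocycle_class w.
Proof.
move=> /ext_class_eq/cocycle_ext_equivP[f fz].
apply/ext_class_eq/cocycle_ext_equivP; exists f => a.
rewrite ffunE (canRL (addrK _) (fz a)).
by rewrite [_ - _ - z' a]addrAC addrK addrAC subrK.
Qed.

(** The classes of z have equicardinal fibres because the fibres are cosets, so a bijection
between the fibres of h lifts to cocycles: fix a representative of each class and, in
moving a class e to phi e, keep the difference of a cocycle with the representative. *)
Lemma card_cocycle_fibre U V (T : eqType) (h : Ext U V -> T) (s t : T) :
  ([set e | h e = s] #= [set e | h e = t])%card ->
  #|[pred z : cocycle U V | h (cocycle_class z) == s]| =
  #|[pred z : cocycle U V | h (cocycle_class z) == t]|.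
Proof.
wlog suff H : s t / ([set e | h e = s] #= [set e | h e = t])%card ->
  (#|[pred z : cocycle U V | h (cocycle_class z) == s]| <=
   #|[pred z : cocycle U V | h (cocycle_class z) == t]|)%N.
  move=> st; apply/eqP; rewrite eqn_leq !H //.
  by rewrite card_eq_sym.
move=> /(card_eq_inj (cocycle_class [ffun => 0]))[phi phif phiinj].
have /choice[lift liftK] := @cocycle_class_onto U V.
pose psi (z : cocycle U V) :=
  translate z (lift (cocycle_class z)) (lift (phi (cocycle_class z))).
have psiE z : cocycle_class (psi z) = phi (cocycle_class z).
  by rewrite class_translate liftK.
rewrite -(@card_in_image _ _ psi).
  apply/subset_leq_card/fintype.subsetP => _ /fintype.imageP[z + ->].
  by rewrite !inE psiE => /eqP zs; apply/eqP; exact: phif.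
move=> z z'; rewrite !inE => /eqP zs /eqP z's zz'.
have cz : cocycle_class z = cocycle_class z'.
  by apply: phiinj; rewrite // -!psiE zz'.
rewrite -[z](translateK _ (lift (cocycle_class z)) (lift (phi (cocycle_class z)))).
rewrite -[z'](translateK _ (lift (cocycle_class z)) (lift (phi (cocycle_class z)))).
by move: zz'; rewrite /psi cz => ->.
Qed.

End ExtensionCounting.

(** * Hall numbers as probabilities *)

Section Probability.
Variables (R : realType) (k : finFieldType) (Q : quiver).
Implicit Types U V W : rep k Q.
Implicit Types u v w m : isoclass k Q.

(** The probability that a uniformly random extension of U by V has middle term isomorphic
to W. *)
Definition ext_prob U V W : R[i] :=
  #|[pred z : cocycle U V | isomorphic (cocycle_rep z) W]|%:R / #|{: cocycle U V}|%:R.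

Lemma natr_neq0 (n : nat) : (0 < n)%N -> n%:R != 0 :> R[i].
Proof. by rewrite pnatr_eq0 lt0n. Qed.

Lemma card_field_neq0 : #|k|%:R != 0 :> R[i].
Proof. by apply: natr_neq0; apply/card_gt0P; exists 0. Qed.

(** The two sums in the Euler form are the dimensions of the spaces of cochains and of
cocycles. *)
Lemma mult_euler_formE U V :
  mult_euler_form R k U V = #|{: cochain U V}|%:R / #|{: cocycle U V}|%:R.
Proof.
rewrite /mult_euler_form /euler_form expfzDr ?card_field_neq0 //.
have natE (I : finType) (f g : I -> nat) :
    \sum_i (f i)%:Z * (g i)%:Z = (\sum_i f i * g i)%N%:Z.
  rewrite (big_morph Posz PoszD (erefl (Posz 0))).
  by apply: eq_bigr => i _; rewrite PoszM.
by rewrite !natE -exprnN card_cochain card_cocycle !natrX.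
Qed.

Lemma aut_order_neq0 U : (aut_order U)%:R != 0 :> R[i].
Proof. exact/natr_neq0/aut_order_gt0. Qed.

(** The equality of counts in [card_cocycle_iso], divided by the number of cocycles: a_M is
what has to be absorbed in the basis for the structure constants to be
probabilities. *)
Lemma hall_number_prob U V W :
  mult_euler_form R k U V * (hall_number U V W)%:R =
  (aut_order W)%:R * ext_prob U V W / ((aut_order U)%:R * (aut_order V)%:R).
Proof.
have := congr1 (fun n => n%:R : R[i]) (card_cocycle_iso U V W).
rewrite !natrM mult_euler_formE /ext_prob.
set h := (hall_number U V W)%:R; set c := #|{: cochain U V}|%:R.
set z := #|{: cocycle U V}|%:R; set N := #|_|%:R => E.
have z0 : z != 0 := natr_neq0 (card_cocycle_gt0 U V).
have UV0 : (aut_order U)%:R * (aut_order V)%:R != 0 :> R[i] by rewrite mulf_neq0 ?aut_order_neq0.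
apply: (mulIf UV0); rewrite mulfVK // [RHS]mulrA [_ * N]mulrC E.
by rewrite -[LHS]mulrA mulrAC.
Qed.

Lemma ext_probE U V W :
  ext_prob U V W = mult_euler_form R k U V * (hall_number U V W)%:R *
                   ((aut_order U)%:R * (aut_order V)%:R) / (aut_order W)%:R.
Proof.
rewrite hall_number_prob mulfVK ?mulf_neq0 ?aut_order_neq0 //.
by rewrite mulrAC mulfV ?aut_order_neq0 // mul1r.
Qed.

(** For U and V this goes through [ext_probE], since Hall numbers visibly depend only on
isomorphism classes whereas cocycles of isomorphic pairs would have to be
transported. *)
Lemma ext_prob_iso U U' V V' W W' :
    isomorphic U U' -> isomorphic V V' -> isomorphic W W' ->
  ext_prob U V W = ext_prob U' V' W'.
Proof.
move=> UU VV WW; transitivity (ext_prob U V W').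
  by congr (_%:R / _); apply: eq_card => z; rewrite !inE; exact: isomorphicr.
have dimE (M N : rep k Q) : isomorphic M N -> dimv M = dimv N.
  by move=> MN; apply: funext => v; exact: isomorphic_dim.
have hallE : hall_number U V W' = hall_number U' V' W'.
  by apply: eq_card => S; rewrite !inE (isomorphicr _ UU) (isomorphicr _ VV).
by rewrite !ext_probE hallE (dimE _ _ UU) (dimE _ _ VV) (aut_order_iso UU)
  (aut_order_iso VV).
Qed.

Lemma ext_prob_neq0_hall U V W : ext_prob U V W != 0 -> hall_number U V W != 0%N.
Proof. by apply: contra_neq => h0; rewrite ext_probE h0 mulr0 !mul0r. Qed.

Definition class_prob u v w : R[i] :=
  ext_prob (class_repr u) (class_repr v) (class_repr w).

Lemma class_reprP U : isomorphic (class_repr (class_of U)) U.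
Proof. exact/class_of_eq/class_reprK. Qed.

Lemma class_probE U V W :
  class_prob (class_of U) (class_of V) (class_of W) = ext_prob U V W.
Proof. by apply: ext_prob_iso; exact: class_reprP. Qed.

Definition middles u v : seq (isoclass k Q) :=
  undup [seq class_of (cocycle_rep z) | z : cocycle (class_repr u) (class_repr v)].

Lemma middles_uniq u v : uniq (middles u v).
Proof. exact: undup_uniq. Qed.

Lemma class_prob_count u v w :
  class_prob u v w = (\sum_(z : cocycle (class_repr u) (class_repr v))
     (class_of (cocycle_rep z) == w))%N%:R /
     #|{: cocycle (class_repr u) (class_repr v)}|%:R.
Proof.
congr (_%:R / _); rewrite -sum1_card big_mkcond; apply: eq_bigr => z _.
rewrite inE -[w in RHS]class_reprK; congr nat_of_bool.
by apply/idP/eqP => /class_of_eq.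
Qed.

Lemma mem_middles u v (z : cocycle (class_repr u) (class_repr v)) :
  class_of (cocycle_rep z) \in middles u v.
Proof. by rewrite mem_undup fintype.image_f. Qed.

Lemma class_prob_middles u v w : class_prob u v w != 0 -> w \in middles u v.
Proof.
apply: contraNT => wnot; rewrite class_prob_count big1 ?mul0r // => z _.
by apply/eqP; rewrite eqb0; apply: contraNneq wnot => <-; exact: mem_middles.
Qed.

(** * The Hall product in the rescaled basis *)

(** The coefficient of x on a_M [M] instead of [M]. *)
Definition normalized (x : hall R k Q) u : R[i] :=
  x u / (aut_order (class_repr u))%:R.

Lemma normalized_neq0 x u : (normalized x u != 0) = (x u != 0).
Proof. by rewrite mulf_eq0 invr_eq0 negb_or aut_order_neq0 andbT. Qed.

(** In the rescaled basis the structure constants are the probabilities [class_prob]; the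
factor in front only converts back to the basis of the [M]. *)
Lemma hall_mulE (x y : hall R k Q) w :
  hall_mul x y w = (aut_order (class_repr w))%:R *
    \sum_(p \in [set: isoclass k Q * isoclass k Q])
      normalized x p.1 * normalized y p.2 * class_prob p.1 p.2 w.
Proof.
rewrite /hall_mul mulr_fsumr; apply: eq_fsbigr => p _.
rewrite hall_number_prob invfM /normalized -/(class_prob p.1 p.2 w).
move: (class_prob _ _ _) => t.
by rewrite [in RHS]mulrACA -[X in _ = _ * X]mulrA [RHS]mulrCA -[_ * t * _]mulrA [t * _]mulrC.
Qed.

Lemma hall_mul_neq0 (x y : hall R k Q) w : hall_mul x y w != 0 ->
  exists u v, [/\ x u != 0, y v != 0 & class_prob u v w != 0].
Proof.
apply: contra_neqP => xyw; rewrite hall_mulE fsbig1 ?mulr0 // => -[u v] _ /=.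
apply/eqP/contraT; rewrite 2!mulf_eq0 !negb_or !normalized_neq0 -andbA => /and3P[].
by move=> xu yv uvw; case: xyw; exists u, v.
Qed.

(** A representation has finitely many subrepresentations, so it is an extension for
finitely many pairs of classes only. *)
Lemma class_prob_cover n : exists2 r : seq (isoclass k Q * isoclass k Q),
  uniq r & forall u v, class_prob u v n != 0 -> (u, v) \in r.
Proof.
have /finite_seqP[r rE] := hall_number_finite (class_repr n).
exists (undup r) => [|u v uvn]; first exact: undup_uniq.
rewrite mem_undup; have : [set` r] (u, v); last by [].
by rewrite -rE /=; exact: ext_prob_neq0_hall uvn.
Qed.

End Probability.

(** * Action of the functor on cocycles *)

Section Transport.
Variables (R : realType) (k : finFieldType) (Q Q' : quiver) (F : functor k Q Q').
Hypothesis Fexact : exact_functor F.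
Hypothesis ext_equicard : forall (U V : rep k Q) (c d : Ext (F U) (F V)),
  ([set e : Ext U V | ext_map Fexact e = c]
     #= [set e : Ext U V | ext_map Fexact e = d])%card.

(** Uniform cocycles give uniform extension classes on both sides, and the map on Ext
preserves uniformity; hence the image under F of a random extension of U by V has the
same distribution of middle terms as a random extension of F U by F V. *)
Lemma card_functor_cocycle (U V : rep k Q) (N : rep k Q') :
  (#|[pred z : cocycle U V | isomorphic (F (cocycle_rep z)) N]| *
     #|{: cocycle (F U) (F V)}| =
   #|[pred z : cocycle (F U) (F V) | isomorphic (cocycle_rep z) N]| *
     #|{: cocycle U V}|)%N.
Proof.
pose P (c : Ext (F U) (F V)) := isomorphic (ext_mid (ext_repr c)) N.
have PE (e : extension (F U) (F V)) : P (ext_class e) = isomorphic (ext_mid e) N.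
  apply: isomorphicl; have /ext_class_eq/ext_equivP[f [fi _ _]] := ext_reprK (ext_class e).
  by apply/existsP; exists f.
have := @card_pred_of_equal_fibres _ _ _
  (fun z : cocycle U V => ext_map Fexact (cocycle_class z))
  (fun z : cocycle (F U) (F V) => cocycle_class z) P.
rewrite (@eq_card _ [pred z : cocycle U V | P (ext_map Fexact (cocycle_class z))]
   [pred z : cocycle U V | isomorphic (F (cocycle_rep z)) N]); last first.
  by move=> z; rewrite !inE /cocycle_class ext_mapE PE.
rewrite (@eq_card _ [pred z : cocycle (F U) (F V) | P (cocycle_class z)]
   [pred z : cocycle (F U) (F V) | isomorphic (cocycle_rep z) N]); last first.
  by move=> z; rewrite !inE /cocycle_class PE.
apply.
  by move=> c d; apply: card_cocycle_fibre; exact: ext_equicard.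
move=> c d; apply: (card_cocycle_fibre (h := id)).
rewrite (_ : [set e | id e = c] = [set c]) // (_ : [set e | id e = d] = [set d]) //.
exact: eq_card1.
Qed.

Local Notation Fc := (class_map F).

(** The form of [card_functor_cocycle] used for the product: summed over the classes m that
F sends to n, the probabilities for (u, v) give the probability of n for
(F u, F v). *)
Lemma sum_class_prob (u v : isoclass k Q) (n : isoclass k Q') (r : seq (isoclass k Q)) :
  uniq r -> {subset middles u v <= r} ->
  \sum_(m <- r | Fc m == n) class_prob R u v m = class_prob R (Fc u) (Fc v) n.
Proof.
move=> ur sub; pose U := class_repr u; pose V := class_repr v.
have z0 (q : quiver) (A B : rep k q) : #|{: cocycle A B}|%:R != 0 :> R[i].
  exact: natr_neq0 (card_cocycle_gt0 A B).
under eq_bigr do rewrite class_prob_count.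
rewrite -mulr_suml -natr_sum exchange_big /=.
rewrite -[n in RHS]class_reprK class_probE /ext_prob.
apply: (mulIf (z0 _ U V)); rewrite mulfVK // mulrAC.
apply: (mulIf (z0 _ (F U) (F V))); rewrite mulfVK // -!natrM -card_functor_cocycle.
congr (_ * _)%N%:R; rewrite -sum1_card [RHS]big_mkcond; apply: eq_bigr => z _.
rewrite inE; have zr : class_of (cocycle_rep z) \in r by exact/sub/mem_middles.
rewrite big_mkcond (bigD1_seq _ zr ur) /= eqxx big1 ?addn0 => [|m].
  rewrite class_mapE -[n in LHS]class_reprK; congr (if _ then _ else _).
  by apply/eqP/idP => /class_of_eq.
by rewrite eq_sym => /negbTE ->; case: ifP.
Qed.

Lemma class_prob_map_neq0 (u v m : isoclass k Q) :
  class_prob R u v m != 0 -> class_prob R (Fc u) (Fc v) (Fc m) != 0.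
Proof.
move=> uvm; have mid := class_prob_middles uvm.
rewrite -(sum_class_prob _ (middles_uniq u v)) //.
rewrite psumr_neq0.
  by apply/hasP; exists m => //; rewrite eqxx lt_def uvm /ext_prob /class_prob divr_ge0.
by move=> i _; rewrite /class_prob /ext_prob divr_ge0.
Qed.

(** * The induced map of Hall algebras *)

Implicit Types (x y : hall R k Q).

(** In the rescaled bases the map of the theorem has no coefficient left. *)
Lemma hall_pushE x n : hall_push F x n =
  (aut_order (class_repr n))%:R * \sum_(m \in [set m | Fc m = n]) normalized x m.
Proof.
rewrite /hall_push mulr_fsumr; apply: eq_fsbigr => m; rewrite inE => <-.
rewrite /normalized /class_map (aut_order_iso (class_reprP _)).
by rewrite mulrCA.
Qed.

Lemma dom_cover x (s : seq (isoclass k Q')) : hall_push_dom F R x ->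
  exists2 r, uniq r & forall u, x u != 0 -> Fc u \in s -> u \in r.
Proof.
move=> xD; elim: s => [|n s [r ur xr]]; first by exists [::].
have /finite_seqP[r' r'E] := xD n.
exists (undup (r' ++ r)) => [|u xu]; first exact: undup_uniq.
rewrite in_cons mem_undup mem_cat => /orP[/eqP un|us]; last by rewrite xr ?orbT.
have : [set` r'] u; first by rewrite -r'E.
by move=> /= ->.
Qed.

(** Ranges for all the sums in the coefficient of n in a product: s contains the pairs of
which n is an extension, su and sv the classes in the supports of x and y that F sends
to components of such pairs, and sm the extensions of classes of su by classes of
sv. *)
Lemma product_cover x y n : hall_push_dom F R x -> hall_push_dom F R y ->
  exists s su sv sm,
    [/\ [/\ uniq s, uniq su, uniq sv & uniq sm],
        forall u v, class_prob R u v n != 0 -> (u, v) \in s,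
        forall p u, p \in s -> x u != 0 -> Fc u = p.1 -> u \in su,
        forall p v, p \in s -> y v != 0 -> Fc v = p.2 -> v \in sv &
        {in su & sv, forall u v, {subset middles u v <= sm}}].
Proof.
move=> xD yD; have [s us sE] := class_prob_cover R n.
have [su usu suE] := dom_cover [seq p.1 | p <- s] xD.
have [sv usv svE] := dom_cover [seq p.2 | p <- s] yD.
exists s, su, sv, (undup (flatten [seq middles u v | u <- su, v <- sv])).
split=> // [|p u ps xu up|p v ps yv vp|u v us' vs m muv].
- by rewrite undup_uniq.
- by apply: suE => //; rewrite up map_f.
- by apply: svE => //; rewrite vp map_f.
rewrite mem_undup; apply/flattenP; exists (middles u v) => //.
by apply/allpairsP; exists (u, v).
Qed.

Lemma hall_push_dom_mul x y :
  hall_push_dom F R x -> hall_push_dom F R y -> hall_push_dom F R (hall_mul x y).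
Proof.
move=> xD yD n; have [s [su [sv [sm [_ sE suE svE smE]]]]] := product_cover n xD yD.
apply: (@sub_finite_set _ _ [set` sm]); last exact: finite_seq.
move=> m [/hall_mul_neq0[u [v [xu yv uvm]]] mn].
have ps : (Fc u, Fc v) \in s by apply: sE; rewrite -mn; exact: class_prob_map_neq0.
by apply: (smE u v); [exact: suE ps _ _|exact: svE ps _ _|exact: class_prob_middles uvm].
Qed.

(** Both coefficients of n are sums over u and v of the product of the rescaled
coefficients of x and y with a probability: on the left, that F sends a random
extension of u by v to n; on the right, that a random extension of F u by F v is n. *)
Lemma hall_push_mul x y : hall_push_dom F R x -> hall_push_dom F R y ->
  hall_push F (hall_mul x y) = hall_mul (hall_push F x) (hall_push F y).
Proof.
move=> xD yD; apply: funext => n.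
have [s [su [sv [sm [[us usu usv usm] sE suE svE smE]]]]] := product_cover n xD yD.
have cover u v m : x u != 0 -> y v != 0 -> class_prob R u v m != 0 -> Fc m = n ->
    u \in su /\ v \in sv.
  move=> xu yv uvm mn.
  have ps : (Fc u, Fc v) \in s by apply: sE; rewrite -mn; exact: class_prob_map_neq0.
  by split; [exact: suE ps _ _|exact: svE ps _ _].
have mulE m : Fc m = n -> normalized (hall_mul x y) m =
    \sum_(u <- su) \sum_(v <- sv) normalized x u * normalized y v * class_prob R u v m.
  move=> mn; rewrite /normalized hall_mulE mulrAC mulfV ?aut_order_neq0 // mul1r.
  rewrite (@fsum_seq _ _ _ predT [seq (u, v) | u <- su, v <- sv]) //.
  - by rewrite big_allpairs.
  - by apply: allpairs_uniq => // -[? ?] [? ?].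
  move=> [u v] _ /=; rewrite 2!mulf_eq0 !negb_or !normalized_neq0 -andbA => /and3P[xu yv uvm].
  by have [us' vs] := cover _ _ _ xu yv uvm mn; apply/allpairsP; exists (u, v).
rewrite hall_pushE hall_mulE; congr (_ * _).
rewrite (@fsum_seq _ _ _ (fun m => Fc m == n) sm) //; first last.
- move=> m mn; rewrite normalized_neq0 => /hall_mul_neq0[u [v [xu yv uvm]]].
  have [us' vs] := cover _ _ _ xu yv uvm mn.
  exact: (smE u v) (class_prob_middles uvm).
- by move=> m; split=> /eqP.
rewrite (eq_bigr _ (fun m mn => mulE m (eqP mn))).
rewrite exchange_big /=.
rewrite (@fsum_seq _ _ _ predT s) //; last first.
  by move=> [u v] _; rewrite 2!mulf_eq0 !negb_or -andbA => /and3P[_ _]; exact: sE.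
have pushE p : p \in s ->
   normalized (hall_push F x) p.1 = \sum_(u <- su | Fc u == p.1) normalized x u /\
   normalized (hall_push F y) p.2 = \sum_(v <- sv | Fc v == p.2) normalized y v.
  move=> ps; split; rewrite /normalized hall_pushE mulrAC mulfV ?aut_order_neq0 // mul1r.
    apply: fsum_seq => // [u|u up]; first by split=> /eqP.
    by rewrite normalized_neq0 => xu; exact: suE ps xu up.
  apply: fsum_seq => // [v|v vp]; first by split=> /eqP.
  by rewrite normalized_neq0 => yv; exact: svE ps yv vp.
rewrite [RHS]big_seq; under [RHS]eq_bigr => p ps.
  have [-> ->] := pushE p ps; rewrite big_distrlr mulr_suml /=.
  under eq_bigr do rewrite mulr_suml.
  over.
(* For fixed u and v the only pair left in the sum over s is (F u, F v). *)
rewrite -big_seq [RHS](exchange_big_dep predT) //=; apply: eq_big_seq => u us'.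
rewrite [LHS]exchange_big [RHS](exchange_big_dep predT) //=.
apply: eq_big_seq => v vs.
rewrite -!mulr_sumr (sum_class_prob _ usm) => [|m]; last exact: smE.
congr (_ * _); rewrite (eq_bigl (pred1 (Fc u, Fc v))) => [|[p1 p2]]; last first.
  by rewrite /= xpair_eqE eq_sym [Fc v == _]eq_sym.
have [ps|pNs] := boolP ((Fc u, Fc v) \in s).
  by rewrite -big_filter filter_pred1_uniq // big_seq1.
rewrite big1_seq => [|p /andP[/eqP -> ps]]; last by rewrite ps in pNs.
by apply/eqP; apply: contraNT pNs; exact: sE.
Qed.

Lemma hall_push_basis (M : rep k Q) :
  hall_push F (hall_basis (class_of M)) =
  ((aut_order (F M))%:R / (aut_order M)%:R : R[i]) *: hall_basis (class_of (F M)).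
Proof.
apply: funext => n; rewrite /hall_push.
rewrite (@fsum_seq _ _ _ (fun m => Fc m == n) [:: class_of M]) //; first last.
- move=> m _; rewrite /hall_basis inE; case: (m =P _) => // _.
  by rewrite mul0r eqxx.
- by move=> m; split=> /eqP.
rewrite big_mkcond big_seq1 class_mapE /hall_basis eqxx mul1r.
rewrite (aut_order_iso (class_reprP M)).
have /existsP[f fi] := class_reprP M.
have -> : aut_order (F (class_repr (class_of M))) = aut_order (F M).
  by apply: aut_order_iso; apply/existsP; exists (fmap F f); exact: fmap_iso.
rewrite eq_sym; set c := _ / _; rewrite -[RHS]/(c * (n == class_of (F M))%:R).
by case: (n == _); rewrite ?mulr1 ?mulr0.
Qed.

(** The sequence 0 -> 0 -> 0 with identity maps is exact, and so is its image under F: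
all of F 0 lies in the kernel of its identity, which is 0. *)
Lemma functor_rep0 : isomorphic (F (rep0 k Q)) (rep0 k Q').
Proof.
have id_exact : short_exact (hom_id (rep0 k Q)) (hom_id (rep0 k Q)).
  move=> v; rewrite hom_id_at; split; rewrite ?row_free_unit ?row_full_unit ?unitmx1 //.
  by apply/andP; split; rewrite [X in (X <= _)%MS]thinmx0 sub0mx.
have dim0 v : F (rep0 k Q) v = 0%N.
  have [_ /andP[/sub_kermxP ker _] _] := Fexact id_exact v; move: ker.
  by rewrite fmap_id hom_id_at mul1mx => /(congr1 mxrank); rewrite mxrank1 mxrank0.
have fc a : rep_map (F (rep0 k Q)) a *m (0 : 'M[k]_(F (rep0 k Q) (head a), rep0 k Q' (head a)))
  = 0 *m rep_map (rep0 k Q') a by rewrite mulmx0 mul0mx.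
apply/existsP; exists (@mk_hom _ _ (F (rep0 k Q)) (rep0 k Q') (fun v => 0) fc).
apply: iso_of_bijective => v; rewrite mk_homE /row_free /row_full mxrank0 //.
by rewrite dim0.
Qed.

Lemma aut_order_rep0 (q : quiver) : aut_order (rep0 k q) = 1%N.
Proof.
rewrite -(card1 (hom_id (rep0 k q))); apply: eq_card => f; rewrite !inE.
have -> : f = hom_id _ by apply: hom_ext => v; rewrite [LHS]flatmx0 [RHS]flatmx0.
by rewrite is_iso_id eqxx.
Qed.

Lemma hall_push_one : hall_push F (hall_one : hall R k Q) = hall_one.
Proof.
rewrite /hall_one hall_push_basis aut_order_rep0 divr1.
rewrite (aut_order_iso functor_rep0) aut_order_rep0 scale1r.
by congr hall_basis; apply/class_of_eq/functor_rep0.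
Qed.

Lemma hall_push_linear (a : R[i]) x y :
  hall_push_dom F R x -> hall_push_dom F R y ->
  hall_push F (a *: x + y) = a *: hall_push F x + hall_push F y.
Proof.
move=> xD yD; apply: funext => n.
have [rx urx xE] := dom_cover [:: n] xD; have [ry ury yE] := dom_cover [:: n] yD.
pose r := undup (rx ++ ry); have ur : uniq r by exact: undup_uniq.
have pushE (z : hall R k Q) : (forall m, z m != 0 -> Fc m = n -> m \in r) ->
  hall_push F z n = \sum_(m <- r | Fc m == n) z m *
   ((aut_order (F (class_repr m)))%:R / (aut_order (class_repr m))%:R).
  move=> zE; apply: fsum_seq => // [m|m mn]; first by split=> /eqP.
  by rewrite mulf_eq0 negb_or => /andP[zm _]; exact: zE.
have xr m : x m != 0 -> Fc m = n -> m \in r.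
  by move=> xm mn; rewrite mem_undup mem_cat xE ?inE ?mn ?eqxx.
have yr m : y m != 0 -> Fc m = n -> m \in r.
  by move=> ym mn; rewrite mem_undup mem_cat (yE m) ?inE ?mn ?eqxx ?orbT.
have E : (a *: x + y) =1 (fun m => a * x m + y m :> R[i]) by [].
rewrite pushE; last first.
  move=> m; rewrite E; have [xm|xm] := eqVneq (x m) 0; last by move=> _; exact: xr.
  by rewrite xm mulr0 add0r; exact: yr.
transitivity (a * hall_push F x n + hall_push F y n) => //.
rewrite !pushE // mulr_sumr -big_split; apply: eq_bigr => m _ /=.
by rewrite E mulrDl -mulrA.
Qed.

Lemma hall_push_dom_linear (a : R[i]) x y :
  hall_push_dom F R x -> hall_push_dom F R y -> hall_push_dom F R (a *: x + y).
Proof.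
move=> xD yD n.
apply: (@sub_finite_set _ _ ([set m | x m != 0 /\ Fc m = n] `|` [set m | y m != 0 /\ Fc m = n])).
  move=> m [+ mn].
  have -> : (a *: x + y) m = a * x m + y m :> R[i] by [].
  have [->|xm] := eqVneq (x m) 0; last by left.
  by rewrite mulr0 add0r; right.
by rewrite finite_setU.
Qed.

End Transport.

Theorem theorem7p1 (R : realType) (k : finFieldType) (Q Q' : quiver)
    (F : functor k Q Q') (Fexact : exact_functor F)
    (ext_onto : forall (U V : rep k Q) (c : Ext (F U) (F V)),
       exists e : Ext U V, ext_map Fexact e = c)
    (ext_equicard : forall (U V : rep k Q) (c d : Ext (F U) (F V)),
       [set e : Ext U V | ext_map Fexact e = c]
         #= [set e : Ext U V | ext_map Fexact e = d]) :
  [/\ forall M : rep k Q,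
        hall_push F (hall_basis (class_of M))
        = ((aut_order (F M))%:R / (aut_order M)%:R : R[i])
          *: hall_basis (class_of (F M)),
      is_hall_subalgebra (hall_push_dom F R) &
      is_hall_morphism_on (hall_push_dom F R) (hall_push F)].
Proof.
split; first by move=> M; exact: hall_push_basis.
  split; first exact: hall_push_dom_basis.
  - exact: hall_push_dom_linear.
  - exact: (hall_push_dom_mul ext_equicard).
split; first exact: hall_push_one.
- exact: hall_push_linear.
- exact: (hall_push_mul ext_equicard).
Qed.
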